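(* Let $\mathcal{T}$ be a finite tree with maximum degree $\Delta$, and $w:V(\mathcal{T})\to\mathbb{R}_{\ge0}$. Then $$\mathtt{cent}(\mathcal{T},w)\le\left(2-\frac{1}{2^{\Delta}}\right)\cdot\mathtt{OPT}(\mathcal{T},w).$$
   Context: For a subgraph $\mathcal{H}$ of $\mathcal{T}$, $w(\mathcal{H})=\sum_{x\in V(\mathcal{H})}w(x)$. A search tree on a tree $\mathcal{T}$ is a rooted tree $T$ with vertex set $V(\mathcal{T})$ defined recursively: its root is an arbitrary vertex $r$, and the children of $r$ are the roots of search trees built on the connected components of $\mathcal{T}-r$; a single-vertex tree has only itself as search tree. $\mathtt{cost}_w(T)=\sum_x w(x)\,\mathtt{depth}_T(x)$ with root depth $1$; $\mathtt{OPT}(\mathcal{T},w)$ is the minimum cost over all search trees on $\mathcal{T}$. A vertex $v$ is a centroid of $(\mathcal{T},w)$ if each component $\mathcal{H}$ of $\mathcal{T}-v$ has $w(\mathcal{H})\le w(\mathcal{T})/2$. A search tree $T$ is a centroid tree if each vertex $x$ is a centroid of $(\mathcal{T}[V(T_x)],w)$, $T_x$ being the subtree of $T$ rooted at $x$. $\mathtt{cent}(\mathcal{T},w)$ is the maximum cost of a centroid tree of $(\mathcal{T},w)$. *)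

(* Defs.v *)
From mathcomp Require Import all_boot all_order all_algebra.
Set Implicit Arguments. Unset Strict Implicit. Unset Printing Implicit Defensive.
Import Order.TTheory GRing.Theory Num.Theory.
Local Open Scope ring_scope.

Section Defs.
Variables (V : finType) (e : rel V).

Definition acyclic : Prop :=
  forall (x : V) (p : seq V),
    path e x p -> uniq (x :: p) -> (2 <= size p)%N -> ~~ e (last x p) x.

Definition is_tree : Prop :=
  irreflexive e /\ symmetric e /\ (forall x y, connect e x y) /\ acyclic.

Definition maxdeg : nat := (\max_(v : V) #|[set u | e v u]|)%N.

Definition induced (A : {set V}) : rel V :=
  [rel x y | [&& x \in A, y \in A & e x y]].

Definition comp_of (A : {set V}) (x : V) : {set V} :=
  [set y in A | connect (induced A) x y].

Definition components (A : {set V}) : {set {set V}} :=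
  [set comp_of A x | x in A].

(* Search trees, with an extra predicate P r S required at every node r
   whose subtree has vertex set S.  A search tree on S is recorded by its
   depth function d (root has depth 1): the root r of S has depth 1, and for
   every component C of T[S] - r, the vertices of C get depth 1 + their
   depth in a search tree on C. *)
Inductive stree (P : V -> {set V} -> Prop) : {set V} -> (V -> nat) -> Prop :=
  | stree_node (S : {set V}) (r : V) (d : V -> nat) :
      r \in S -> P r S -> d r = 1%N ->
      (forall C, C \in components (S :\ r) ->
         exists dC : V -> nat,
           stree P C dC /\ (forall x, x \in C -> d x = (dC x).+1)) ->
      stree P S d.

Variable R : realFieldType.

Definition wsum (w : V -> R) (A : {set V}) : R := \sum_(x in A) w x.

Definition centroid (w : V -> R) (v : V) (S : {set V}) : Prop :=
  forall H, H \in components (S :\ v) -> wsum w H <= wsum w S / 2.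

Definition search_tree (d : V -> nat) : Prop :=
  stree (fun _ _ => True) [set: V] d.

Definition centroid_tree (w : V -> R) (d : V -> nat) : Prop :=
  stree (centroid w) [set: V] d.

Definition cost (w : V -> R) (d : V -> nat) : R :=
  \sum_(x : V) w x * (d x)%:R.

End Defs.

(* Main.v *)
(* Let r be the root of the optimal tree on S, c the centroid of S, and T the
   part of S - c containing r.  Restricting the optimal tree to the components
   of S - c saves at least 1 on every vertex outside T, since r is no longer
   above it.  As w(T) <= w(S)/2, charging w(S) to these savings gives the factor
   2.  The improvement follows the chain S, T, ... of sets containing r.  Let C
   be the component of S - r containing c and q the child of r in C.  If q is in
   T, everything outside T saves 2.  If q is not in T, the restriction to T saves
   1 on all of C /\ T as well; this saving is banked and pays for the next
   centroid taken in C.  So only the first centroid in each of the at most Delta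
   directions at r saves too little, and along these steps w at least halves.
   Potential with a unused directions: (2^-a - 2^-Delta) w(S). *)
Require Import Defs.
From mathcomp Require Import all_boot all_order all_algebra.
From mathcomp Require Import ring lra.
Import Order.TTheory GRing.Theory Num.Theory.
Local Open Scope ring_scope.
Set Implicit Arguments.

(** The case of a single saved level: [b] and [s] are the weights outside and inside [T], and [p],
    [g] stand for [2^-a] before and after the step. The terms in [eps] cancel, leaving at most
    [- (1 - p) * (b - s)]. *)
Lemma gain_once {R : realFieldType} {p g : R} (eps : R) {b s : R} :
  p <= 1 -> 0 <= s -> s <= b -> p *+ 2 <= g ->
  (1 - (2 - eps)) * b + s - (g - eps) * s + (p - eps) * (b + s) <= 0.
Proof.
move=> p_le1 s_ge0 s_le_b; rewrite -subr_ge0 => /mulr_ge0/(_ s_ge0) gs.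
have : 0 <= (1 - p) * (b - s) by rewrite mulr_ge0 ?subr_ge0.
lra.
Qed.

(** Two levels saved on [b], possibly one of them drawn from the bank; then [g] need not grow. The
    left side is at most [- (2 - eps - p) * b]. *)
Lemma gain_twice {R : realFieldType} {p g eps b s : R} :
  p <= 1 -> 0 <= s -> s <= b -> eps <= 1 -> p <= g ->
  (1 - (2 - eps) * 2) * b + s - (g - eps) * s + (p - eps) * (b + s) <= 0.
Proof.
move=> p_le1 s_ge0 s_le_b eps_le1; rewrite -subr_ge0 => /mulr_ge0/(_ s_ge0) gs.
have : 0 <= (2 - eps - p) * b by rewrite mulr_ge0 //; lra.
lra.
Qed.

(** * Connected components of induced subgraphs *)

Section Components.
Variables (V : finType) (e : rel V).
Hypothesis e_sym : symmetric e.
Implicit Types (A S C H K : {set V}) (x y z r c : V).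

Definition connected S : Prop :=
  forall x y, x \in S -> y \in S -> connect (induced e S) x y.

Lemma sub_induced A S : A \subset S -> subrel (connect (induced e A)) (connect (induced e S)).
Proof.
move=> /subsetP sAS; apply: connect_sub => x y /and3P[xA yA exy].
by apply: connect1; rewrite /induced /= !sAS.
Qed.

Lemma induced_sym A : connect_sym (induced e A).
Proof.
apply: sym_connect_sym => x y; rewrite /induced /= e_sym.
by rewrite andbCA.
Qed.

Lemma comp_of_sub A x : comp_of e A x \subset A.
Proof. by apply/subsetP => y; rewrite inE => /andP[]. Qed.

Lemma comp_of_id A x : x \in A -> x \in comp_of e A x.
Proof. by move=> xA; rewrite inE xA connect0. Qed.

Lemma comp_of_eq A x y : y \in comp_of e A x -> comp_of e A y = comp_of e A x.
Proof.
rewrite inE => /andP[_ xy]; apply/setP => z; rewrite !inE.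
by rewrite (same_connect (@induced_sym A) xy).
Qed.

Lemma comp_ofS A S x : A \subset S -> comp_of e A x \subset comp_of e S x.
Proof.
move=> sAS; apply/subsetP => y; rewrite !inE => /andP[yA xy].
by rewrite (subsetP sAS) //= (sub_induced sAS).
Qed.

Lemma mem_comp_of A x : x \in A -> comp_of e A x \in components e A.
Proof. exact: imset_f. Qed.

Lemma componentsP A C x : C \in components e A -> x \in C ->
  x \in A /\ C = comp_of e A x.
Proof.
case/imsetP => y yA -> xC; split; first exact: (subsetP (comp_of_sub A y)).
by rewrite (comp_of_eq xC).
Qed.

Lemma components_sub A C : C \in components e A -> C \subset A.
Proof. by case/imsetP => y _ ->; exact: comp_of_sub. Qed.

Lemma components_neq0 A C : C \in components e A -> exists x, x \in C.
Proof. by case/imsetP => y yA ->; exists y; exact: comp_of_id. Qed.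

(** A path of [A] starting at [x] never leaves the component of [x]; induction on its last edge
    turns it into a path of the graph induced on that component. *)
Lemma comp_of_connected A x : x \in A -> connected (comp_of e A x).
Proof.
move=> xA.
have from_x y : y \in comp_of e A x -> connect (induced e (comp_of e A x)) x y.
  rewrite inE => /andP[_ /connectP[p]].
  elim/last_ind: p y => [|p z IHp] y /=; first by move=> _ ->; exact: connect0.
  rewrite rcons_path last_rcons => /andP[xp pz] ->.
  have xl := IHp _ xp erefl; apply: (connect_trans xl); apply: connect1.
  case/and3P: pz => lA zA lz; have cl : connect (induced e A) x (last x p).
    by apply/connectP; exists p.
  rewrite /induced /= !inE lA zA cl lz /= andbT.
  by apply: (connect_trans cl); apply: connect1; rewrite /induced /= lA zA lz.
move=> y z yC zC; apply: (connect_trans _ (from_x z zC)).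
by rewrite induced_sym; exact: from_x.
Qed.

Lemma component_connected A C : C \in components e A -> connected C.
Proof. by case/imsetP => x xA ->; exact: comp_of_connected. Qed.

Lemma connected_sub_comp A K x : K \subset A -> connected K -> x \in K ->
  K \subset comp_of e A x.
Proof.
move=> sKA cK xK; apply/subsetP => y yK; rewrite inE (subsetP sKA) //=.
by apply: (sub_induced sKA); exact: cK.
Qed.

(** On a path from [x] to [c] inside [S], the vertex just before the first visit to [c]
    qualifies. *)
Lemma comp_of_neighbour S c x : connected S -> c \in S -> x \in S :\ c ->
  exists2 u, u \in comp_of e (S :\ c) x & e u c.
Proof.
move=> cS cInS xS; have xInS : x \in S by case/setD1P: xS.
have /connectP[p] := cS x c xInS cInS.
elim: p x xS {xInS} => [|z p IHp] x xS /=.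
  by move=> _ cx; rewrite -cx !inE eqxx in xS.
case/andP => /and3P[_ zS xz] pz lz.
have [zc|zc] := eqVneq z c; first by exists x; [exact: comp_of_id | rewrite -zc].
have zS' : z \in S :\ c by rewrite !inE zc.
have [u uz uc] := IHp z zS' pz lz; exists u => //.
rewrite -(@comp_of_eq _ x z) // inE zS' /=.
by apply: connect1; rewrite /induced /= xS zS'.
Qed.

(** The component of [y] in [S :\ c] avoids [r] and contains a neighbour of [c], so it leads from
    [y] to [c] without meeting [r]. *)
Lemma mem_comp_of_removed S r c y : connected S -> r \in S -> c \in S -> c != r ->
  y \in S -> y \notin comp_of e (S :\ c) r -> y \in comp_of e (S :\ r) c.
Proof.
move=> cS rS cIn cr yS yNr.
have [->|yc] := eqVneq y c; first by rewrite comp_of_id // !inE cr.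
have ySc : y \in S :\ c by rewrite !inE yc.
have [u uy uc] := comp_of_neighbour cS cIn ySc.
have rNy : r \notin comp_of e (S :\ c) y.
  apply: contra yNr => ry; rewrite (comp_of_eq ry); exact: comp_of_id.
have sub : comp_of e (S :\ c) y \subset S :\ r.
  apply/subsetP => z zy; have zr : z != r by apply: contraNneq rNy => <-.
  by rewrite in_setD1 zr; have /setD1P[] := subsetP (comp_of_sub _ _) _ zy.
have uS := subsetP sub _ uy.
have yr : y != r by apply: contraNneq yNr => ->; rewrite comp_of_id // !inE eq_sym cr.
rewrite inE in_setD1 yr yS /= induced_sym.
have yu := comp_of_connected ySc (comp_of_id ySc) uy. apply: (connect_trans (sub_induced sub _ _ yu)).
by apply: connect1; rewrite /induced /= uS uc !inE cr cIn.
Qed.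

Lemma big_components (R : nmodType) (F : V -> R) A :
  \sum_(x in A) F x = \sum_(C in components e A) \sum_(x in C) F x.
Proof.
rewrite (partition_big (comp_of e A) (mem (components e A))) => [|x xA]; last exact: mem_comp_of.
apply: eq_bigr => C CA; apply: eq_bigl => x; apply/andP/idP.
  by case=> xA /eqP <-; exact: comp_of_id.
by move=> /(componentsP CA)[xA ->].
Qed.

(** * Search trees as depth functions: roots, gluing, children *)

Section SearchTrees.
Variable P : V -> {set V} -> Prop.

Lemma stree_inv S (d : V -> nat) : stree e P S d ->
  exists r, [/\ r \in S, P r S, d r = 1%N &
    forall C, C \in components e (S :\ r) -> exists dC : V -> nat,
      stree e P C dC /\ forall x, x \in C -> d x = (dC x).+1].
Proof. by case=> {}S r {}d *; exists r. Qed.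

Lemma stree_gt0 S (d : V -> nat) x : stree e P S d -> x \in S -> (0 < d x)%N.
Proof.
case/stree_inv => r [rS _ dr dC] xS; have [->|xr] := eqVneq x r; first by rewrite dr.
have xSr : x \in S :\ r by rewrite !inE xr.
by have [d' [_ ->]] := dC _ (mem_comp_of xSr); rewrite ?comp_of_id.
Qed.

(** A depth function does not name its root; depth 1 identifies it, so the decomposition is
    available at any vertex known to have depth 1. *)
Lemma stree_root S (d : V -> nat) r : stree e P S d -> r \in S -> d r = 1%N ->
  [/\ P r S, forall x, x \in S -> d x = 1%N -> x = r &
    forall C, C \in components e (S :\ r) -> exists dC : V -> nat,
      stree e P C dC /\ forall x, x \in C -> d x = (dC x).+1].
Proof.
case/stree_inv => r' [r'S Pr' dr' dC] rS dr.
have uniq x : x \in S -> d x = 1%N -> x = r'.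
  move=> xS dx; apply: contra_eq dx => xr.
  have xSr : x \in S :\ r' by rewrite !inE xr.
  have [d' [std' ->]] := dC _ (mem_comp_of xSr); last exact: comp_of_id.
  have d'_gt0 := stree_gt0 std' (comp_of_id xSr).
  by rewrite eqSS -lt0n.
by rewrite (uniq r rS dr); split.
Qed.

(** Finite choice picks one depth function per component. The relation [G] carries any pointwise
    bound on depths over to the glued tree. *)
Lemma stree_glue S r (G : V -> nat -> Prop) : r \in S -> P r S ->
  (forall K, K \in components e (S :\ r) -> exists dK : V -> nat,
     stree e P K dK /\ forall x, x \in K -> G x (dK x).+1) ->
  exists d : V -> nat, [/\ stree e P S d, d r = 1%N &
     forall x, x \in S :\ r -> G x (d x)].
Proof.
move=> rS PrS glue.
have /fin_all_exists[f fP] : forall K : {set V}, exists dK : V -> nat,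
    K \in components e (S :\ r) ->
    stree e P K dK /\ forall x, x \in K -> G x (dK x).+1.
  move=> K; case: (boolP (K \in _)) => [/glue[dK ?]|_]; first by exists dK.
  by exists (fun=> 0%N).
pose d x := if x == r then 1%N else (f (comp_of e (S :\ r) x) x).+1.
have dE K x : K \in components e (S :\ r) -> x \in K -> d x = (f K x).+1.
  move=> KS xK; have [/setD1P[/negbTE xr _] ->] := componentsP KS xK.
  by rewrite /d xr.
have dr : d r = 1%N by rewrite /d eqxx.
exists d; split=> //.
  apply: (stree_node rS PrS dr) => K KS; exists (f K); split.
    by have [] := fP _ KS.
  by move=> x xK; exact: dE.
move=> x xS; have KS := mem_comp_of xS; rewrite (dE _ _ KS (comp_of_id xS)).
by have [_] := fP _ KS; apply; exact: comp_of_id.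
Qed.

Lemma stree_gt1 S (d : V -> nat) r x : stree e P S d -> r \in S -> d r = 1%N ->
  x \in S :\ r -> (1 < d x)%N.
Proof.
move=> std rS dr /setD1P[xr xS]; have [_ uniq_r _] := stree_root std rS dr.
rewrite ltn_neqAle (stree_gt0 std xS) andbT eq_sym.
by apply: contra_neq xr; exact: uniq_r.
Qed.

Lemma stree_child S (d : V -> nat) r C : stree e P S d -> r \in S -> d r = 1%N ->
  C \in components e (S :\ r) ->
  exists q, [/\ q \in C, d q = 2%N & forall x, x \in C -> d x = 2%N -> x = q].
Proof.
move=> std rS dr CS; have [_ _ /(_ C CS)[d' [std' dE]]] := stree_root std rS dr.
have [q [qC _ d'q _]] := stree_inv std'; exists q; split=> //.
  by rewrite dE ?d'q.
have [_ uniq_q _] := stree_root std' qC d'q.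
by move=> x xC; rewrite dE // => -[]; exact: uniq_q.
Qed.

(** Each child of the root is sent to a neighbour of the root in its own component. This is
    injective because components are disjoint and each holds a single vertex of depth 2. *)
Lemma card_children S (d : V -> nat) : connected S -> stree e P S d ->
  (#|[set x in S | d x == 2%N]| <= maxdeg e)%N.
Proof.
move=> cS std; have [r [rS _ dr _]] := stree_inv std.
set Q := [set _ in _ | _]; have QS x : x \in Q -> x \in S :\ r.
  by rewrite !inE => /andP[-> /eqP dx]; rewrite andbT; apply: contra_eqN dx => /eqP ->; rewrite dr.
pose f x := odflt x [pick u in comp_of e (S :\ r) x | e r u].
have fP x : x \in Q -> f x \in comp_of e (S :\ r) x /\ e r (f x).
  move=> /QS xS; rewrite /f; case: pickP => [u /andP[] //|none].
  have [u uC ur] := comp_of_neighbour cS rS xS.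
  by have := none u; rewrite /= uC e_sym ur.
have f_inj : {in Q &, injective f}.
  move=> x y xQ yQ fxy; have [fx _] := fP x xQ; have [fy _] := fP y yQ.
  have [q [_ _ uniq_q]] := stree_child std rS dr (mem_comp_of (QS x xQ)).
  have Cxy : comp_of e (S :\ r) y = comp_of e (S :\ r) x.
    by rewrite -(comp_of_eq fx) fxy (comp_of_eq fy).
  have [dx dy] : d x = 2%N /\ d y = 2%N.
    by move: xQ yQ; rewrite !inE => /andP[_ /eqP ->] /andP[_ /eqP ->].
  transitivity q; first by apply: uniq_q dx; exact: comp_of_id (QS x xQ).
  by apply/esym/uniq_q; rewrite // -Cxy; exact: comp_of_id (QS y yQ).
rewrite -(card_in_imset f_inj).
apply: (@leq_trans #|[set u | e r u]|); last exact: (leq_bigmax r).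
by apply: subset_leq_card; apply/subsetP => _ /imsetP[x xQ ->]; rewrite inE; have [] := fP x xQ.
Qed.

End SearchTrees.

(** * Restricting a search tree to a connected subset *)

Notation search := (stree e (fun _ _ => True)).

(** If [r] lies in [K] it stays the root, and each component of [K :\ r] is handled inside its
    component of [S :\ r]; otherwise [K] lies in one such component, whose subtree is restricted.
    The last clause provides the saving to be banked: a level vanishes when the child of [r] above
    [x] is cut off from [x]. *)
Lemma search_restrict S (d : V -> nat) K : search S d ->
  K \subset S -> connected K -> (exists x, x \in K) ->
  exists d' : V -> nat, [/\ search K d',
    forall x, x \in K -> (d' x <= d x)%N,
    forall r, r \in S -> d r = 1%N -> r \notin K ->
      forall x, x \in K -> (d' x < d x)%N
  & forall r, r \in S -> d r = 1%N -> r \in K ->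
      forall x q, x \in K :\ r -> q \in comp_of e (S :\ r) x -> d q = 2%N ->
        q \notin comp_of e (K :\ r) x -> (d' x < d x)%N].
Proof.
move: {2}#|S| (leqnn #|S|) => n; elim: n S d K => [|n IHn] S d K.
  rewrite leqn0 cards_eq0 => /eqP -> _ /subsetP sK _ [x /sK].
  by rewrite inE.
move=> leSn std sK cK [x xK]; have [r [rS _ dr dC]] := stree_inv std.
have root_r r' : r' \in S -> d r' = 1%N -> r' = r.
  by have [_ + _] := stree_root std rS dr; apply.
have ltSn C : C \in components e (S :\ r) -> (#|C| <= n)%N.
  move=> /components_sub /subset_leq_card leC; apply: (leq_trans leC).
  by move: leSn; rewrite (cardsD1 r S) rS.
(* Passing to a subtree below [r] saves one level, and a second one if its root [q] is missing from
   [K']. When [r] is kept, gluing gives one level back, so only the second counts. *)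
have restrict K' y : K' \subset S :\ r -> connected K' -> y \in K' ->
    exists d' : V -> nat, search K' d' /\ forall z, z \in K' ->
      (d' z < d z)%N /\ forall q, q \in comp_of e (S :\ r) z -> d q = 2%N ->
        q \notin K' -> ((d' z).+1 < d z)%N.
  move=> sK' cK' yK'; have sKC := connected_sub_comp sK' cK' yK'.
  have CS : comp_of e (S :\ r) y \in components e (S :\ r).
    by apply: mem_comp_of; exact: (subsetP sK').
  have [d1 [std1 d1E]] := dC _ CS.
  have [|d' [std' le_d' lt_d' _]] := IHn _ _ _ (ltSn _ CS) std1 sKC cK'.
    by exists y.
  exists d'; split=> // z zK; have zC := subsetP sKC _ zK.
  rewrite d1E //; split; first by rewrite ltnS le_d'.
  move=> q; rewrite (comp_of_eq zC) => qC dq qK.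
  by rewrite ltnS (lt_d' q) //; move: dq; rewrite d1E // => -[].
case: (boolP (r \in K)) => rK.
  pose G z m := (m <= d z)%N /\ forall q, q \in comp_of e (S :\ r) z ->
     d q = 2%N -> q \notin comp_of e (K :\ r) z -> (m < d z)%N.
  have [|K' K'K|d' [std' d'r d'G]] := @stree_glue (fun _ _ => True) K r G rK.
  - by [].
  - have [y yK'] := components_neq0 K'K.
    have sK' : K' \subset S :\ r.
      by apply: (subset_trans (components_sub K'K)); exact: setSD.
    have [d' [std' d'P]] := restrict K' y sK' (component_connected K'K) yK'.
    exists d'; split=> // z zK'; have [lt_d' lt2_d'] := d'P z zK'; split=> //.
    move=> q qC dq; have [_ <-] := componentsP K'K zK'; exact: lt2_d' qC dq.
  exists d'; split=> //.
  - move=> z zK; have [->|zr] := eqVneq z r; first by rewrite d'r dr.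
    by have [|] := d'G z _; rewrite // !inE zr.
  - by move=> r' r'S dr'; rewrite (root_r r') ?rK.
  - move=> r' r'S dr' _ z q; rewrite (root_r r') // => zK qC dq qK.
    by have [_ lt_d'] := d'G z zK; exact: lt_d' qC dq qK.
have sK' : K \subset S :\ r by rewrite subsetD1 sK rK.
have [d' [std' d'P]] := restrict K x sK' cK xK; exists d'; split=> //.
- by move=> z zK; apply: ltnW; have [] := d'P z zK.
- by move=> r' r'S dr' _ z zK; have [] := d'P z zK.
- by move=> r' r'S dr'; rewrite (root_r r') // (negbTE rK).
Qed.

(** * Weighted depths and the effect of lowering them *)

Section Costs.
Variables (R : realFieldType) (w : V -> R).
Hypothesis w_ge0 : forall x, 0 <= w x.

Definition cost_on S (d : V -> nat) : R := \sum_(x in S) w x * (d x)%:R.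

Lemma wsum_ge0 S : 0 <= wsum w S.
Proof. by apply: sumr_ge0. Qed.

Lemma wsumS A S : A \subset S -> wsum w A <= wsum w S.
Proof.
move=> sAS; rewrite /wsum [leRHS](big_setID A) /= (setIidPr sAS) lerDl.
by apply: sumr_ge0.
Qed.

Lemma cost_on_shift S (d d' : V -> nat) k :
  (forall x, x \in S -> (d' x + k <= d x)%N) ->
  cost_on S d' + k%:R * wsum w S <= cost_on S d.
Proof.
move=> le_d; rewrite /cost_on /wsum big_distrr -big_split /=.
apply: ler_sum => x xS; rewrite [k%:R * _]mulrC -mulrDr -natrD.
by rewrite ler_wpM2l // ler_nat le_d.
Qed.

Lemma cost_onS S (d d' : V -> nat) : (forall x, x \in S -> d x = (d' x).+1) ->
  cost_on S d = cost_on S d' + wsum w S.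
Proof.
move=> dE; rewrite /cost_on /wsum -big_split; apply: eq_bigr => x xS.
by rewrite dE // -natr1 mulrDr mulr1.
Qed.

Lemma cost_on_drop S (d d' : V -> nat) : (forall x, x \in S -> (d' x <= d x)%N) ->
  cost_on S d' + wsum w [set x in S | (d' x < d x)%N] <= cost_on S d.
Proof.
move=> le_d; rewrite /cost_on /wsum.
rewrite [X in _ + X](eq_bigl (fun x => (x \in S) && (d' x < d x)%N)); last first.
  by move=> x; rewrite inE.
rewrite big_mkcondr -big_split; apply: ler_sum => x xS /=.
case: ifP => [lt_d|_]; last by rewrite addr0 ler_wpM2l // ler_nat le_d.
by rewrite -[X in _ + X]mulr1 -mulrDr ler_wpM2l // natr1 ler_nat.
Qed.

(** * The potential and the induction along the centroid tree *)

Local Notation eps := ((2 ^+ maxdeg e)^-1 : R).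
Local Notation gap Q := ((2 ^+ #|Q : {set V}|)^-1 - eps : R).

Lemma pow2V_itv n : 0 < (2 ^+ n)^-1 :> R /\ (2 ^+ n)^-1 <= 1 :> R.
Proof.
by rewrite invr_gt0 exprn_gt0 // invf_le1 ?exprn_gt0 // exprn_ege1 // ler1n.
Qed.

Lemma pow2V_anti m n : (m <= n)%N -> (2 ^+ n)^-1 <= (2 ^+ m)^-1 :> R.
Proof.
by move=> le_mn; rewrite lef_pV2 ?posrE ?exprn_gt0 // ler_weXn2l // ler1n.
Qed.

(* Q contains the children of r whose direction is unused; D is the set on which
   one extra unit of depth has already been saved. *)
Lemma centroid_cost_on n S r (d dc : V -> nat) (Q D : {set V}) :
  (#|S| <= n)%N -> connected S -> search S d -> stree e (centroid e w) S dc ->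
  r \in S -> d r = 1%N ->
  (forall q, q \in S -> d q = 2%N -> q \in Q \/ comp_of e (S :\ r) q \subset D) ->
  cost_on S dc + gap Q * wsum w S <= (2 - eps) * (cost_on S d + wsum w (D :&: S)).
Proof.
have [eps_gt0 eps_le1] := pow2V_itv (maxdeg e).
have alpha_ge0 : 0 <= 2 - eps by lra.
elim: n S r d dc Q D => [|n IHn] S r d dc Q D.
  by rewrite leqn0 cards_eq0 => /eqP -> _ _ _; rewrite inE.
move=> leSn cS std stdc rS dr QD.
have [c [cIn centr_c dcc dcC]] := stree_inv stdc.
have ltSn C : C \in components e (S :\ c) -> (#|C| <= n)%N.
  move=> /components_sub /subset_leq_card leC; apply: (leq_trans leC).
  by move: leSn; rewrite (cardsD1 c S) cIn.
have side H dH k : H \in components e (S :\ c) -> search H dH ->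
    (forall x, x \in H -> (dH x + k <= d x)%N) ->
    cost_on H dc <= (1 - (2 - eps) * k%:R) * wsum w H + (2 - eps) * cost_on H d.
  move=> HS stdH le_dH; have [dcH [stdcH dcE]] := dcC H HS.
  have cH := component_connected HS.
  have [rH [rHH _ drH _]] := stree_inv stdH.
  pose QH := [set x in H | dH x == 2%N].
  have QHP q : q \in H -> dH q = 2%N -> q \in QH \/ comp_of e (H :\ rH) q \subset set0.
    by move=> qH dq; left; rewrite inE qH dq.
  have := IHn H rH dH dcH QH set0 (ltSn H HS) cH stdH stdcH rHH drH QHP.
  rewrite set0I {2}/wsum big_set0 addr0 (cost_onS _ _ dcE).
  have gap_ge0 : 0 <= gap QH * wsum w H.
    by rewrite mulr_ge0 ?wsum_ge0 // subr_ge0 pow2V_anti // (card_children cH stdH).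
  have := ler_wpM2l alpha_ge0 (cost_on_shift _ _ _ le_dH); lra.
have [gQ_gt0 gQ_le1] := pow2V_itv #|Q|.
have wD_ge0 := wsum_ge0 (D :&: S).
have wS_ge0 := wsum_ge0 S.
have decomp F : \sum_(x in S) F x = F c +
    \sum_(C in components e (S :\ c)) \sum_(x in C) F x :> R.
  by rewrite (big_setD1 c) //= -big_components.
(* If the centroid is [r] itself, every component saves one level, and the gap is absorbed because
   [2^-|Q|] is at most 1. *)
have [cr|cr] := eqVneq c r.
  have : \sum_(C in components e (S :\ c)) cost_on C dc <=
      (1 - (2 - eps) * 1%:R) * \sum_(C in components e (S :\ c)) wsum w C +
      (2 - eps) * \sum_(C in components e (S :\ c)) cost_on C d.
    rewrite 2!big_distrr -big_split /=; apply: ler_sum => H HS.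
    have [_ _ /(_ H)] := stree_root std rS dr; rewrite -cr => /(_ HS)[dH [stdH dE]].
    by apply: (side H dH 1%N HS stdH) => x xH; rewrite dE // addn1.
  have -> : cost_on S dc = w c + \sum_(C in components e (S :\ c)) cost_on C dc.
    by rewrite /cost_on decomp dcc mulr1.
  have -> : cost_on S d = w c + \sum_(C in components e (S :\ c)) cost_on C d.
    by rewrite /cost_on decomp cr dr mulr1.
  have wE : wsum w S = w c + \sum_(C in components e (S :\ c)) wsum w C.
    exact: decomp.
  have := mulr_ge0 alpha_ge0 wD_ge0.
  have := ler_wpM2r wS_ge0 gQ_le1.
  rewrite wE; lra.
have rc : r \in S :\ c by rewrite !inE eq_sym cr.
have cSr : c \in S :\ r by rewrite !inE cr.
set T := comp_of e (S :\ c) r; have TS : T \in components e (S :\ c) by exact: mem_comp_of.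
have sTS : T \subset S by apply: (subset_trans (comp_of_sub _ _)); exact: subD1set.
have rT : r \in T by exact: comp_of_id.
set C := comp_of e (S :\ r) c; have CS : C \in components e (S :\ r) by exact: mem_comp_of.
have notT_C y : y \in S -> y \notin T -> y \in C by exact: mem_comp_of_removed.
have [q [qC dq _]] := stree_child std rS dr CS.
have [_ uniq_r dC] := stree_root std rS dr.
have {dC} [d1 [std1 d1E]] := dC C CS.
have d1q : d1 q = 1%N by move: dq; rewrite d1E // => -[].
have [dT [stdT le_dT _ lt_dT]] := search_restrict std sTS (component_connected TS) (ex_intro _ r rT).
have dTr : dT r = 1%N.
  by apply/eqP; rewrite eqn_leq (stree_gt0 stdT rT) -[X in (_ <= X)%N]dr le_dT.
have [dcT [stdcT dcTE]] := dcC T TS.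
(* The old bank inside [T], together with the vertices just lifted by the restriction to [T]. *)
pose DT := (D :&: T) :|: [set x in T | (dT x < d x)%N].
have QDT x : x \in T -> dT x = 2%N -> x \in Q :&: T \/ comp_of e (T :\ r) x \subset DT.
  move=> xT dTx; have xr : x != r by apply: contra_eqN dTx => /eqP ->; rewrite dTr.
  have xTr : x \in T :\ r by rewrite in_setD1 xr.
  have xSr : x \in S :\ r by rewrite !inE xr (subsetP sTS).
  have sTr : T :\ r \subset S :\ r by exact: setSD.
  have [p [pC dp _]] := stree_child std rS dr (mem_comp_of xSr).
  have pS : p \in S by have /setD1P[] := subsetP (comp_of_sub _ _) p pC.
  have [pQ|pD] := QD p pS dp; last first.
    right; rewrite /DT; apply: subset_trans (subsetUl _ _); rewrite subsetI.
    rewrite (comp_of_eq pC) in pD; rewrite (subset_trans (comp_ofS _ sTr) pD) /=.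
    by apply: (subset_trans (comp_of_sub _ _)); exact: subD1set.
  have [pK|pK] := boolP (p \in comp_of e (T :\ r) x).
    left; have pTr := subsetP (comp_of_sub _ _) p pK.
    have pT : p \in T by case/setD1P: pTr.
    have [k [kK _ uniq_k]] := stree_child stdT rT dTr (mem_comp_of xTr).
    have dTp : dT p = 2%N.
      apply/eqP; rewrite eqn_leq (stree_gt1 stdT rT dTr pTr) andbT.
      by rewrite -dp le_dT.
    rewrite (uniq_k x (comp_of_id xTr) dTx) -(uniq_k p pK dTp).
    by rewrite inE pQ pT.
  right; apply/subsetP => z zK; have zTr := subsetP (comp_of_sub _ _) z zK.
  have zT : z \in T by case/setD1P: zTr.
  have zC := subsetP (comp_ofS _ sTr) z zK.
  have lt_z : (dT z < d z)%N.
    by apply: (lt_dT r rS dr rT z p) => //; rewrite ?(comp_of_eq zC) ?(comp_of_eq zK).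
  by rewrite in_setU [X in _ || X]inE zT lt_z orbT.
have := IHn T r dT dcT (Q :&: T) DT (ltSn T TS) (component_connected TS) stdT stdcT rT dTr QDT.
have -> : DT :&: T = DT.
  by apply/setIidPl; rewrite subUset subsetIr; apply/subsetP => x; rewrite inE => /andP[].
(* The growth of the bank costs nothing: by [dT_drop], the search cost on [T] falls by at least the
   weight of the lifted vertices. *)
have wDT : wsum w DT <= wsum w (D :&: T) + wsum w [set x in T | (dT x < d x)%N].
  rewrite /wsum (big_setID (D :&: T)) /= (setIidPr (subsetUl _ _)) lerD2l.
  by apply: wsumS; rewrite setDUl setDv set0U subsetDl.
have dT_drop := cost_on_drop _ _ le_dT.
clear QDT lt_dT.
set g := (2 ^+ #|Q :&: T|)^-1 => IH_T.
have decompT F : \sum_(x in S) F x = F c + (\sum_(x in T) F x +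
    \sum_(H in components e (S :\ c) | H != T) \sum_(x in H) F x) :> R.
  by rewrite decomp (bigD1 T TS).
(* These components lie in [C], below [r], which gives the first level; if [q] is in [T], they also
   lose [q], the root of the subtree on [C], which gives the second. *)
have others k : (k <= 2)%N -> (k = 2%N -> q \in T) ->
    \sum_(H in components e (S :\ c) | H != T) cost_on H dc <=
    (1 - (2 - eps) * k%:R) * \sum_(H in components e (S :\ c) | H != T) wsum w H +
    (2 - eps) * \sum_(H in components e (S :\ c) | H != T) cost_on H d.
  move=> k_le2 k2; rewrite 2!big_distrr -big_split /=.
  apply: ler_sum => H /andP[HS HT].
  have notT y : y \in H -> y \notin T.
    move=> yH; apply: contra HT => yT.
    by have [_ ->] := componentsP HS yH; have [_ ->] := componentsP TS yT.
  have sHC : H \subset C.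
    apply/subsetP => y yH; apply: notT_C (notT y yH).
    by have /setD1P[] := subsetP (components_sub HS) y yH.
  have [dH [stdH le_dH lt_dH _]] :=
    search_restrict std1 sHC (component_connected HS) (components_neq0 HS).
  apply: side HS stdH _ => x xH; rewrite d1E ?(subsetP sHC) //.
  case: k k_le2 k2 => [|[|[|//]]] _ k2.
  - by rewrite addn0 leqW ?le_dH.
  - by rewrite addn1 ltnS le_dH.
  rewrite addn2 ltnS (lt_dH q) //.
  by apply: contraL (k2 erefl) => /notT.
have half : wsum w T <= wsum w S / 2 by exact: centr_c.
have dc_gt1 : (1 < d c)%N by exact: stree_gt1 std rS dr cSr.
pose b := wsum w S - wsum w T.
have main k : (k <= 2)%N -> (k = 2%N -> q \in T) ->
    (1 - (2 - eps) * k%:R) * b + wsum w T - (g - eps) * wsum w T +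
      gap Q * (b + wsum w T) + (2 - eps) * wsum w (D :&: T) <=
      (2 - eps) * wsum w (D :&: S) ->
    cost_on S dc + gap Q * wsum w S <= (2 - eps) * (cost_on S d + wsum w (D :&: S)).
  move=> k_le2 k2; have {others} := others k k_le2 k2.
  have -> : cost_on S dc = w c + (cost_on T dc +
      \sum_(H in components e (S :\ c) | H != T) cost_on H dc).
    by rewrite /cost_on decompT dcc mulr1.
  have -> : cost_on S d = w c * (d c)%:R + (cost_on T d +
      \sum_(H in components e (S :\ c) | H != T) cost_on H d).
    exact: decompT.
  have bE : b = w c + \sum_(H in components e (S :\ c) | H != T) wsum w H.
    by have := decompT w; rewrite -/(wsum w S) -/(wsum w T) /b => ->; ring.
  have -> : wsum w S = b + wsum w T by rewrite /b subrK.
  rewrite (cost_onS _ _ dcTE) {b}bE.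
  (* As [d c] is at least 2, [c] obeys the same bound as the other vertices outside [T]. *)
  have wcd : (2 - eps) * (w c * k%:R) <= (2 - eps) * (w c * (d c)%:R).
    rewrite ler_wpM2l // ler_wpM2l //.
    by rewrite ler_nat (leq_trans k_le2).
  have := ler_wpM2l alpha_ge0 dT_drop.
  have := ler_wpM2l alpha_ge0 wDT.
  lra.
have T_le_b : wsum w T <= b by rewrite /b; lra.
have T_ge0 := wsum_ge0 T.
have wDTS : wsum w (D :&: T) <= wsum w (D :&: S) by apply: wsumS; exact: setIS.
have le_g : (2 ^+ #|Q|)^-1 <= g by apply: pow2V_anti; exact: subset_leq_card (subsetIl _ _).
have qS : q \in S by have /setD1P[] := subsetP (comp_of_sub _ _) q qC.
have wDTS_alpha := ler_wpM2l alpha_ge0 wDTS.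
have twice := gain_twice gQ_le1 T_ge0 T_le_b eps_le1 le_g.
have [qQ|qQ] := boolP (q \in Q); last first.
  (* The direction of [q] is already used: all of [S :\: T] lies in [C], hence in [D], and the bank
     releases [b]. With the one level saved, this amounts to two. *)
  have CD : C \subset D.
    have [qQ'|] := QD q qS dq; first by rewrite qQ' in qQ.
    by rewrite (comp_of_eq qC).
  have wDT_b : wsum w (D :&: T) + b <= wsum w (D :&: S).
    have wS_split : wsum w S = wsum w T + wsum w (S :\: T).
      by rewrite /wsum (big_setID T) /= (setIidPr sTS).
    rewrite /b wS_split [wsum w T + _]addrC addrK.
    rewrite /wsum [leRHS](big_setID (D :&: T)) /= (setIidPr (setIS D sTS)) lerD2l.
    apply: wsumS; apply/subsetP => y /setDP[yS yT].
    by rewrite !in_setD !in_setI yS (negbTE yT) andbF (subsetP CD) ?notT_C.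
  apply: (main 1%N) => //.
  have := ler_wpM2l alpha_ge0 wDT_b; lra.
have [qT|qT] := boolP (q \in T).
  apply: (main 2%N) => //; lra.
apply: (main 1%N) => //.
have le_2g : (2 ^+ #|Q|)^-1 *+ 2 <= g.
  have lt_QT : (#|Q :&: T| < #|Q|)%N.
    apply: proper_card; rewrite properE subsetIl /=.
    by apply: contra qT => /subsetP/(_ q qQ)/setIP[].
  have := pow2V_anti _ _ lt_QT; rewrite exprS invfM -/g; lra.
have := gain_once eps gQ_le1 T_ge0 T_le_b le_2g; lra.
Qed.
End Costs.
End Components.
Unset Implicit Arguments.

(* cent(T,w) <= (2 - 1/2^Delta) * OPT(T,w), unfolded: every centroid tree
   has cost at most (2 - 1/2^Delta) times the cost of every search tree. *)
Theorem theorem4 (R : realFieldType) (V : finType) (e : rel V)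
    (w : V -> R) :
  is_tree e ->
  (forall x, 0 <= w x) ->
  forall dc d : V -> nat,
    centroid_tree e w dc -> search_tree e d ->
    cost w dc <= (2 - (2 ^+ maxdeg e)^-1) * cost w d.
Proof.
move=> [_ [e_sym [e_conn _]]] w_ge0 dc d stdc std.
have costE f : cost w f = cost_on R w [set: V] f.
  by rewrite /cost /cost_on; apply: eq_bigl => x; rewrite inE.
have cV : connected e [set: V].
  move=> x y _ _; rewrite (@eq_connect _ (induced e [set: V]) e) //.
  by move=> u v; rewrite /induced /= !inE.
have [r [rV _ dr _]] := stree_inv std.
pose Q := [set x in [set: V] | d x == 2%N].
have QP q : q \in [set: V] -> d q = 2%N ->
    q \in Q \/ comp_of e ([set: V] :\ r) q \subset set0.
  by move=> qV dq; left; rewrite inE qV dq.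
have := centroid_cost_on e_sym w_ge0 _ (leqnn _) cV std stdc rV dr QP.
rewrite set0I {2}/wsum big_set0 addr0 !costE; apply: le_trans.
rewrite lerDl mulr_ge0 ?wsum_ge0 // subr_ge0 pow2V_anti //.
exact: (card_children e_sym cV std).
Qed.
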